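(* Let $\mathcal{X}$ be a measurable space, $\mu$ a probability measure on $\mathcal{X}$, and $\varphi:\mathcal{X}\to\mathbb{R}$ a measurable function. For all $0<\rho<1$ and $\lambda>0$, $$\operatorname{CVaR}_\rho(\varphi;\mu)+\lambda(\log\rho-1)\ \le\ \lambda F_\rho(\varphi/\lambda;\mu)\ \le\ \operatorname{CVaR}_\rho(\varphi;\mu)+\lambda\left(\log\rho-1+\frac1\rho\right).$$
   Context: The conditional value at risk is $$\operatorname{CVaR}_\rho(\varphi;\mu)=\inf_{\alpha\in\mathbb{R}}\left\{\alpha+\frac1\rho\int_{\mathcal{X}}(\varphi(x)-\alpha)_+\,d\mu(x)\right\},\qquad t_+:=\max\{0,t\}$$ (when $\varphi(X)$, $X\sim\mu$, has a continuous distribution this is $\mathbb{E}[\varphi(X)\mid\varphi(X)\ge Q_{1-\rho}]$ with $Q_{1-\rho}$ the $(1-\rho)$-quantile of $\varphi(X)$). For $0<\rho<1$, define $f_\rho$ on $[0,\infty)$ by $f_\rho(t)=t\log t+1+\frac{1-\rho t}{\rho}\log(1-\rho t)$ for $0\le t\le\frac1\rho$ (with $0\log0=0$) and $f_\rho(t)=+\infty$ otherwise. The Safe KL divergence is $D_\rho(\nu,\mu):=\int_{\mathcal{X}}f_\rho\left(\frac{d\nu}{d\mu}(x)\right)d\mu(x)$ if $\nu\ll\mu$ and $+\infty$ otherwise. With $\mathcal{P}(\mathcal{X})$ the set of probability measures on $\mathcal{X}$, $$F_\rho(\varphi;\mu):=\sup_\nu\left\{\int_{\mathcal{X}}\varphi\,d\nu-D_\rho(\nu,\mu):\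 \nu\in\mathcal{P}(\mathcal{X}),\ \int_{\mathcal{X}}|\varphi|\,d\nu<\infty\right\}.$$ Equivalently, $$F_\rho(\varphi;\mu)=\inf_{\alpha\in\mathbb{R}}\left\{\alpha-1+\frac1\rho\int_{\mathcal{X}}\log\left(1+\rho e^{\varphi(x)-\alpha}\right)d\mu(x)\right\}.$$ *)

(* Defs.v *)
From HB Require Import structures.
From mathcomp Require Import all_boot all_order all_algebra.
From mathcomp Require Import all_classical all_reals all_analysis.

Set Implicit Arguments.
Unset Strict Implicit.
Unset Printing Implicit Defensive.

Import Order.TTheory GRing.Theory Num.Theory.
Import numFieldNormedType.Exports.

Local Open Scope classical_set_scope.
Local Open Scope ring_scope.
Local Open Scope ereal_scope.
Local Open Scope charge_scope.

Definition CVaR d (T : measurableType d) (R : realType) (rho : R)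
    (phi : T -> R) (mu : probability T R) : \bar R :=
  ereal_inf [set a%:E + (rho^-1)%:E *
                 \int[mu]_x (Num.max 0 (phi x - a))%R%:E | a in [set: R]].

(* The convention 0 log 0 = 0 holds here at both endpoints t = 0 and
   t = 1/rho, whatever the value of [ln 0]. *)
Definition f_safe (R : realType) (rho t : R) : \bar R :=
  if (0 <= t <= rho^-1)%R then
    (t * ln t + 1 + (1 - rho * t) / rho * ln (1 - rho * t))%:E
  else +oo.

(* The Radon-Nikodym derivative of the library is \bar R-valued, but it is
   finite everywhere when [nu `<< mu], so [fine] loses nothing. *)
Definition safeKL d (T : measurableType d) (R : realType) (rho : R)
    (nu mu : probability T R) : \bar R :=
  if `[< nu `<< mu >] then
    \int[mu]_x f_safe rho (fine (('d (charge_of_finite_measure nu) '/d mu) x))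
  else +oo.

Definition F_safe d (T : measurableType d) (R : realType) (rho : R)
    (phi : T -> R) (mu : probability T R) : \bar R :=
  ereal_sup [set \int[nu]_x (phi x)%:E - safeKL rho nu mu
            | nu in [set nu : probability T R
                    | \int[nu]_x `|(phi x)%:E| < +oo]].

(* Main.v *)
(* CVaR_rho(phi; mu) is the supremum of [\int phi dnu] over the probability
   measures [nu] whose density with respect to [mu] is at most [1/rho]. On such
   [nu], the entropy term satisfies
     [1 - t log rho - 1/rho <= f_rho(t) <= 1 - t log rho],
   because s log s + (1 - s) log (1 - s) lies in [-1, 0] for s = rho t; hence
   [1 - log rho - 1/rho <= D_rho(nu, mu) <= 1 - log rho]. All other [nu] have
   infinite divergence, so the two suprema differ by these constants. *)

Require Import Defs.
From HB Require Import structures.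
From mathcomp Require Import all_boot all_order all_algebra.
From mathcomp Require Import all_classical all_reals all_analysis.
From mathcomp Require Import measurable_realfun ring lra.

Set Implicit Arguments.
Unset Strict Implicit.
Unset Printing Implicit Defensive.

Import Order.TTheory GRing.Theory Num.Theory.
Import numFieldNormedType.Exports.

Local Open Scope classical_set_scope.
Local Open Scope ring_scope.
Local Open Scope ereal_scope.

(** * Pointwise bounds on the integrand of the Safe KL divergence *)

(** Tangent line of [x ln x] at 1: multiply [ln y <= y - 1] at [y = x^-1] by [x]. At [x = 0] the
    product vanishes whatever [ln 0] is. *)
Lemma xlnx_ge (R : realType) (x : R) : (0 <= x)%R -> (x - 1 <= x * ln x)%R.
Proof.
rewrite le_eqVlt => /predU1P[<-|x0]; first by rewrite mul0r; lra.
have : (ln x^-1 <= x^-1 - 1)%R.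
  rewrite -[X in ln X](subrKC 1%R) le_ln1Dx// ltrBrDl subrr invr_gt0//.
rewrite lnV// => /(ler_wpM2l (ltW x0)).
by rewrite mulrBr mulfV ?gt_eqF// mulr1 mulrN; lra.
Qed.

Section f_safe_bounds.
Context (R : realType) (rho : R).
Hypothesis rho_gt0 : (0 < rho)%R.
Implicit Types t : R.

(** The tangent bound at [t] gives [t - 1]; at [1 - rho * t], after division by [rho], it gives
    [- t]. With the constant 1 these cancel. *)
Lemma f_safe_ge0 t : 0 <= f_safe rho t.
Proof.
rewrite /f_safe; case: ifPn => // /andP[t0 t1]; rewrite lee_fin.
have rt1 : (rho * t <= 1)%R by rewrite mulrC -ler_pdivlMr ?mul1r.
have h1 := xlnx_ge t0.
have h2 : (0 <= 1 - rho * t)%R by lra.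
move: (xlnx_ge h2) => /(ler_wpM2l (ltW (etrans (invr_gt0 rho) rho_gt0))).
have -> : (rho^-1 * (1 - rho * t - 1) = - t)%R by field; rewrite gt_eqF.
by rewrite mulrA -(mulrC (1 - _)%R); lra.
Qed.

(** With [s = rho * t], the tangent bounds at [s] and [1 - s] add up to -1; dividing by [rho]
    produces the term [- rho^-1]. *)
Lemma f_safe_ge t : (1 - t * ln rho - rho^-1)%:E <= f_safe rho t.
Proof.
rewrite /f_safe; case: ifPn => [/andP[t0 t1]|_]; last by rewrite leey.
rewrite lee_fin.
have rt1 : (rho * t <= 1)%R by rewrite mulrC -ler_pdivlMr ?mul1r.
have r0 : (0 <= rho^-1)%R by rewrite invr_ge0 ltW.
have h2 : (0 <= 1 - rho * t)%R by lra.
have h1 : (0 <= rho * t)%R by rewrite mulr_ge0// ltW.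
have lnrt : (t * ln (rho * t) = t * ln rho + t * ln t)%R.
  move: t0; rewrite le_eqVlt => /predU1P[<-|t0]; first by rewrite !mul0r addr0.
  by rewrite lnM ?posrE// mulrDr.
have /(ler_wpM2l r0) := lerD (xlnx_ge h1) (xlnx_ge h2).
have -> : (rho^-1 * (rho * t - 1 + (1 - rho * t - 1)) = - rho^-1)%R.
  by field; rewrite gt_eqF.
have -> : (rho^-1 * (rho * t * ln (rho * t) + (1 - rho * t) * ln (1 - rho * t))
    = t * ln rho + t * ln t + (1 - rho * t) / rho * ln (1 - rho * t))%R.
  by rewrite -lnrt; field; rewrite gt_eqF.
by lra.
Qed.

(** Since [t <= rho^-1], [ln t] is at most [- ln rho], and the term in [1 - rho * t] is nonpositive
    because that number lies in [0, 1]. *)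
Lemma f_safe_le t : (0 <= t <= rho^-1)%R ->
  f_safe rho t <= (1 - t * ln rho)%:E.
Proof.
move=> t01; rewrite /f_safe t01 lee_fin; move: t01 => /andP[t0 t1].
have rt1 : (rho * t <= 1)%R by rewrite mulrC -ler_pdivlMr ?mul1r.
have h1 : (t * ln t <= - (t * ln rho))%R.
  move: t0; rewrite le_eqVlt => /predU1P[<-|t0]; first by rewrite !mul0r oppr0.
  rewrite -mulrN -lnV// ler_wpM2l ?(ltW t0)// ler_ln ?posrE ?invr_gt0//.
have h2 : ((1 - rho * t) / rho * ln (1 - rho * t) <= 0)%R.
  rewrite mulr_ge0_le0//; first by rewrite divr_ge0 ?(ltW rho_gt0)//; lra.
  by rewrite ln_le0//; have := mulr_ge0 (ltW rho_gt0) t0; lra.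
by lra.
Qed.

Lemma measurable_f_safe : measurable_fun [set: R] (fun t => f_safe rho t).
Proof.
rewrite /f_safe; apply: measurable_fun_ifT => //.
  by apply: measurable_and; exact: measurable_fun_ler.
apply/measurable_EFinP; apply: measurable_funD.
  apply: measurable_funD => //.
  by apply: measurable_funM => //; exact: measurable_ln.
have m1 : measurable_fun [set: R] (fun t => 1 - rho * t)%R.
  by apply: measurable_funB => //; exact: measurable_funM.
by apply: measurable_funM; [exact: measurable_funM|
  apply: measurableT_comp => //; exact: measurable_ln].
Qed.

End f_safe_bounds.

(** * Probability measures given by a density with respect to [mu] *)

Lemma integrable_density d (T : measurableType d) (R : realType)
    (mu : probability T R) (g : T -> R) :
  measurable_fun [set: T] g -> (forall x, 0 <= g x)%R ->
  \int[mu]_x (g x)%:E = 1 -> mu.-integrable [set: T] (EFin \o g).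
Proof.
move=> mg g0 g1; apply/integrableP; split; first exact/measurable_EFinP.
by under eq_integral do rewrite /= ger0_norm//; rewrite g1 ltry.
Qed.

Lemma density_probability d (T : measurableType d) (R : realType)
    (mu : probability T R) (g : T -> R) :
  measurable_fun [set: T] g -> (forall x, 0 <= g x)%R ->
  \int[mu]_x (g x)%:E = 1 ->
  exists nu : probability T R,
    forall A, measurable A -> nu A = \int[mu]_(x in A) (g x)%:E.
Proof.
move=> mg g0 g1; pose nu A := \int[mu]_(x in A) (g x)%:E.
have nu0 : nu set0 = 0 by rewrite /nu integral_set0.
have nu_ge0 A : 0 <= nu A by apply: integral_ge0 => x _; rewrite lee_fin.
have nu_sigma : semi_sigma_additive nu.
  move=> /= F mF tF mUF; rewrite /nu; apply: cvg_toP.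
    apply: ereal_nondecreasing_is_cvgn => m n mn.
    by apply: lee_sum_nneg_natr => // k _ _; exact: nu_ge0.
  rewrite ge0_integral_bigcup//=; last by move=> x _; rewrite lee_fin.
  by apply/measurable_funTS/measurable_EFinP.
pose numix := isMeasure.Build _ _ _ nu nu0 nu_ge0 nu_sigma.
pose num : {measure set T -> \bar R} := HB.pack nu numix.
pose numix' := Measure_isProbability.Build _ _ _ num g1.
pose nup : probability T R := HB.pack nu numix numix'.
by exists nup.
Qed.

Section density.
Context d (T : measurableType d) (R : realType) (mu nu : probability T R).
Context (g : T -> R).
Hypothesis mg : measurable_fun [set: T] g.
Hypothesis nuE : forall A, measurable A -> nu A = \int[mu]_(x in A) (g x)%:E.

Lemma dominates_density : nu `<< mu.
Proof.
apply/null_content_dominatesP => A mA muA0; rewrite nuE//.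
by apply: null_set_integral => //; exact/measurable_funTS/measurable_EFinP.
Qed.

(** Both functions integrate to [nu A] over every measurable [A], which determines them up to a
    [mu]-null set. *)
Lemma Radon_Nikodym_density : ae_eq mu [set: T]
  (Radon_Nikodym (charge_of_finite_measure nu) mu) (EFin \o g).
Proof.
apply: integral_ae_eq => //.
- by apply: Radon_Nikodym_integrable; exact: dominates_density.
- exact/measurable_EFinP.
- move=> A _ mA; rewrite -Radon_Nikodym_integral//; last exact: dominates_density.
  by rewrite /= nuE.
Qed.

End density.

(** Valid for infinite integrals too, so it can serve to prove [nu]-integrability, which the change
    of variables for signed functions presupposes. *)
Lemma ge0_Radon_Nikodym_change_of_variables d (T : measurableType d)
    (R : realType) (mu nu : probability T R) (f : T -> \bar R) :
  nu `<< mu -> measurable_fun [set: T] f -> (forall x, 0 <= f x) ->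
  \int[nu]_x f x =
  \int[mu]_x (f x * Radon_Nikodym (charge_of_finite_measure nu) mu x).
Proof.
move=> numu mf f0.
rewrite -(Radon_Nikodym_SigmaFinite.change_of_variables numu)//.
have ? : measurable_fun [set: T] (Radon_Nikodym_SigmaFinite.f nu mu).
  exact: measurable_int (Radon_Nikodym_SigmaFinite.f_integrable _).
have ? : measurable_fun [set: T]
  (Radon_Nikodym (charge_of_finite_measure nu) mu).
  by apply: measurable_int; exact: Radon_Nikodym_integrable.
apply: ae_eq_integral => //; [exact: emeasurable_funM..|].
by apply: ae_eqe_mul2l; exact: ae_eq_Radon_Nikodym_SigmaFinite.
Qed.

Section density_integral.
Context d (T : measurableType d) (R : realType) (mu nu : probability T R).
Context (g : T -> R).
Hypotheses (mg : measurable_fun [set: T] g) (g0 : forall x, (0 <= g x)%R).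
Hypothesis nuE : forall A, measurable A -> nu A = \int[mu]_(x in A) (g x)%:E.
Let numu : nu `<< mu := dominates_density mg nuE.
Let mRN : measurable_fun [set: T]
  (Radon_Nikodym (charge_of_finite_measure nu) mu).
Proof. by apply: measurable_int; exact: Radon_Nikodym_integrable. Qed.

Lemma integrable_densityM (f : T -> R) : measurable_fun [set: T] f ->
  mu.-integrable [set: T] (fun x => (f x * g x)%:E) ->
  nu.-integrable [set: T] (EFin \o f).
Proof.
move=> mf /integrableP[_ fg].
have mf' : measurable_fun [set: T] (EFin \o f) by exact/measurable_EFinP.
apply/integrableP; split => //.
rewrite (ge0_Radon_Nikodym_change_of_variables numu)//; last exact: measurableT_comp.
apply: le_lt_trans fg.
rewrite (@ae_eq_integral _ _ _ mu setT (fun x => `|(f x * g x)%:E|))//.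
- by apply: emeasurable_funM => //; exact: measurableT_comp.
- by apply: measurableT_comp => //; apply/measurable_EFinP; exact: measurable_funM.
- apply: filterS (Radon_Nikodym_density mg nuE) => x /(_ I) /= -> _.
  by rewrite normrM (ger0_norm (g0 x)).
Qed.

Lemma integral_densityM (f : T -> R) :
  nu.-integrable [set: T] (EFin \o f) ->
  \int[nu]_x (f x)%:E = \int[mu]_x (f x * g x)%:E.
Proof.
move=> fi; have /= mf := measurable_int _ fi.
rewrite -(Radon_Nikodym_change_of_variables numu _ fi)//.
apply: ae_eq_integral => //; first exact: emeasurable_funM.
- by apply/measurable_EFinP; apply: measurable_funM => //; exact/measurable_EFinP.
- by apply: filterS (Radon_Nikodym_density mg nuE) => x /(_ I) /= -> _.
Qed.

(** Integrate [f_safe_le] against [mu]: as [g] has integral 1, the term [- t ln rho] contributes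
    exactly [- ln rho]. *)
Lemma safeKL_density_le (rho : R) : (0 < rho < 1)%R ->
  (forall x, (g x <= rho^-1)%R) -> safeKL rho nu mu <= (1 - ln rho)%:E.
Proof.
move=> /andP[rho0 rho1] gr; rewrite /safeKL; case: asboolP => // _.
have mG : measurable_fun [set: T] (fun x => f_safe rho (g x)).
  by apply: measurableT_comp => //; exact: measurable_f_safe.
rewrite (@ae_eq_integral _ _ _ mu setT (fun x => f_safe rho (g x)))//; first last.
- by apply: filterS (Radon_Nikodym_density mg nuE) => x /(_ I) /= -> _.
- apply: (measurableT_comp (measurable_f_safe rho)).
  exact: measurableT_comp.
have g1 : \int[mu]_x (g x)%:E = 1 by rewrite -nuE// probability_setT.
have gi := integrable_density mg g0 g1.
apply: (@le_trans _ _ (\int[mu]_x (1%:E + (- ln rho)%:E * (g x)%:E))).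
  apply: ge0_le_integral => //.
  - by move=> x _; exact: f_safe_ge0.
  - apply: emeasurable_funD => //; apply: emeasurable_funM => //.
    exact/measurable_EFinP.
  - move=> x _; rewrite -EFinM -EFinD mulNr mulrC.
    by apply: f_safe_le => //; rewrite g0 gr.
rewrite integralD//=; last 2 first.
- exact: finite_measure_integrable_cst.
- exact: integrableZl.
rewrite integralZl// g1 integral_cst//= probability_setT.
by rewrite !mule1.
Qed.

End density_integral.

(** * Consequences of a finite divergence *)

Section finite_safeKL.
Context d (T : measurableType d) (R : realType) (mu nu : probability T R).
Context (rho : R).
Hypothesis rho_gt0 : (0 < rho)%R.
Hypothesis safeKL_fin : safeKL rho nu mu < +oo.

Let RN := Radon_Nikodym (charge_of_finite_measure nu) mu.

Let numu : nu `<< mu.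
Proof. by move: safeKL_fin; rewrite /safeKL; case: asboolP => // _; rewrite ltxx. Qed.

Let RN_integrable : mu.-integrable [set: T] RN.
Proof. exact: Radon_Nikodym_integrable. Qed.

Let mRN : measurable_fun [set: T] RN.
Proof. exact: measurable_int RN_integrable. Qed.

Let RN_fin x : RN x \is a fin_num.
Proof. exact: Radon_Nikodym_fin_num. Qed.

Let f_integrable :
  mu.-integrable [set: T] (fun x => f_safe rho (fine (RN x))).
Proof.
apply/integrableP; split.
  apply: (measurableT_comp (measurable_f_safe rho)).
  exact: measurableT_comp.
under eq_integral do rewrite gee0_abs ?f_safe_ge0//.
by move: safeKL_fin; rewrite /safeKL; case: asboolP.
Qed.

(** An integrable function is finite almost everywhere, and [f_safe] is finite only on
    [0, 1/rho]. *)
Lemma Radon_Nikodym_le_of_safeKL : {ae mu, forall x, 0 <= RN x <= (rho^-1)%:E}.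
Proof.
apply: filterS (integrable_ae measurableT f_integrable) => x /(_ I).
by move: (RN_fin x); case: (RN x) => //= r _; rewrite /f_safe !lee_fin; case: ifP.
Qed.

(** Integrate [f_safe_ge] against [mu], using that the derivative has integral 1. *)
Lemma safeKL_ge_of_finite : (1 - ln rho - rho^-1)%:E <= safeKL rho nu mu.
Proof.
have nu1 : \int[mu]_x RN x = 1.
  by rewrite -Radon_Nikodym_integral//= probability_setT.
rewrite [leRHS]/safeKL asboolT//.
apply: (@le_trans _ _ (\int[mu]_x ((1 - rho^-1)%:E + (- ln rho)%:E * RN x))).
  rewrite integralD//=; last 2 first.
  - exact: finite_measure_integrable_cst.
  - exact: integrableZl.
  rewrite integralZl// nu1 integral_cst//= (@probability_setT _ _ _ mu) !mule1.
  by rewrite -EFinD lee_fin; lra.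
apply: le_integral => //.
  apply: integrableD => //; last exact: integrableZl.
  exact: finite_measure_integrable_cst.
move=> x _; move: (RN_fin x); rewrite -/RN; case: (RN x) => //= r _.
rewrite -EFinM -EFinD; apply: le_trans (f_safe_ge rho_gt0 r) => //.
by rewrite lee_fin; lra.
Qed.

(** In effect [nu <= mu / rho] as measures, because the density is at most [rho^-1] almost
    everywhere. *)
Lemma ge0_le_integral_of_safeKL (f : T -> \bar R) :
  measurable_fun [set: T] f -> (forall x, 0 <= f x) ->
  \int[nu]_x f x <= (rho^-1)%:E * \int[mu]_x f x.
Proof.
move=> mf f0; rewrite (ge0_Radon_Nikodym_change_of_variables numu)//.
have r0 : (0 <= rho^-1)%R by rewrite invr_ge0 ltW.
rewrite -ge0_integralZl//.
(* Clamping the derivative to [0, 1/rho] changes it on a null set only and makes the bound hold at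
   every point. *)
rewrite [leLHS](@ae_eq_integral _ _ _ mu setT (fun x => f x * maxe 0 (mine (RN x) (rho^-1)%:E)))//.
- apply: ge0_le_integral => //.
  + by move=> x _; rewrite mule_ge0// le_max lexx.
  + apply: emeasurable_funM => //; apply: measurable_maxe => //.
    exact: measurable_mine.
  + exact: emeasurable_funM.
  + move=> x _; rewrite muleC lee_wpmul2r// ge_max lee_fin r0/=.
    by rewrite ge_min lexx orbT.
- exact: emeasurable_funM.
- apply: emeasurable_funM => //; apply: measurable_maxe => //.
  exact: measurable_mine.
- apply: filterS Radon_Nikodym_le_of_safeKL => x /andP[h0 h1] _.
  by rewrite min_l// max_r.
Qed.

End finite_safeKL.

(** * Existence of quantiles *)

Lemma measurable_superlevel d (T : measurableType d) (R : realType)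
    (phi : T -> R) (a : R) :
  measurable_fun [set: T] phi -> measurable [set x | phi x > a]%R.
Proof.
move=> mphi; rewrite -[X in measurable X]setTI.
rewrite (_ : [set x | _] = phi @^-1` `]a, +oo[%classic); first exact: mphi.
by apply/seteqP; split => x /=; rewrite in_itv/= andbT.
Qed.

(** The witness is the infimum of the upward closed set [S] of levels exceeded with probability at
    most [p]; both inequalities follow by continuity of [mu] along monotone sequences of sets. *)
Lemma exists_quantile d (T : measurableType d) (R : realType)
    (mu : probability T R) (phi : T -> R) (p : R) :
  measurable_fun [set: T] phi -> (0 < p < 1)%R ->
  exists a : R, mu [set x | phi x > a]%R <= p%:E /\
    p%:E <= mu [set x | phi x >= a]%R.
Proof.
move=> mphi /andP[p0 p1].
have mgt a := measurable_superlevel a mphi.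
pose S := [set a | mu [set x | phi x > a]%R <= p%:E].
have Sup a b : S a -> (a <= b)%R -> S b.
  move=> Sa ab; apply: le_trans Sa; apply: le_measure; rewrite ?inE//.
  by move=> x /=; exact: le_lt_trans.
have S0 : S !=set0.
  (* [S] is nonempty: otherwise all these masses would exceed [p > 0], yet they decrease to 0. *)
  have : mu [set x | phi x > n%:R]%R @[n --> \oo] --> mu (\bigcap_n [set x | phi x > n%:R]%R).
    apply: (@nonincreasing_cvg_mu _ _ _ mu (fun n => [set x | phi x > n%:R]%R)) => //.
    - by rewrite (le_lt_trans (probability_le1 _ _))// ltry.
    - exact: bigcap_measurable.
    - move=> m n mn; apply/subsetPset => x /=; apply: le_lt_trans.
      by rewrite ler_nat.
  rewrite (_ : \bigcap_n _ = set0) ?measure0; last first.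
    apply/seteqP; split => // x /(_ (Num.bound `|phi x|%R) I) /=.
    by rewrite ltNge (le_trans (ler_norm _))// ltW// archi_boundP.
  move=> h; apply: contrapT => S_eq0.
  suff : p%:E <= 0 by rewrite lee_fin leNgt p0.
  apply: cvge_ge h; apply: nearW => n; rewrite leNgt; apply/negP => /ltW Sn.
  by apply: S_eq0; exists n%:R.
have Slb : has_lbound S.
  (* If [S] had no lower bound, upward closure would keep all these masses at most [p < 1], yet they
     increase to 1. *)
  have : mu [set x | phi x > - n%:R]%R @[n --> \oo] --> mu (\bigcup_n [set x | phi x > - n%:R]%R).
    apply: (@nondecreasing_cvg_mu _ _ _ mu (fun n => [set x | phi x > - n%:R]%R)) => //.
    - exact: bigcup_measurable.
    - move=> m n mn; apply/subsetPset => x /=; apply: le_lt_trans.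
      by rewrite lerN2 ler_nat.
  rewrite (_ : \bigcup_n _ = setT) ?probability_setT; last first.
    apply/seteqP; split => // x _; exists (Num.bound `|phi x|%R) => //=.
    by rewrite ltrNl (le_lt_trans (ler_norm _))// normrN archi_boundP.
  move=> h; apply: contrapT => S_nlb.
  suff : 1 <= p%:E by rewrite lee_fin leNgt p1.
  apply: cvge_le h; apply: nearW => n; rewrite leNgt; apply/negP => Sn.
  apply: S_nlb; exists (- n%:R)%R => a Sa; rewrite leNgt; apply/negP => /ltW an.
  by have := lt_le_trans Sn (Sup _ _ Sa an); rewrite ltxx.
exists (inf S); split.
  (* Levels above [inf S] belong to [S]; their superlevel sets increase to the strict one at
     [inf S]. *)
  have : mu [set x | phi x > inf S + n.+1%:R^-1]%R @[n --> \oo] -->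
      mu (\bigcup_n [set x | phi x > inf S + n.+1%:R^-1]%R).
    apply: (@nondecreasing_cvg_mu _ _ _ mu (fun n => [set x | phi x > inf S + n.+1%:R^-1]%R)) => //.
    - exact: bigcup_measurable.
    - move=> m n mn; apply/subsetPset => x /=; apply: le_lt_trans.
      by rewrite lerD2l lef_pV2 ?posrE// ler_nat.
  rewrite (_ : \bigcup_n _ = [set x | phi x > inf S]%R); last first.
    apply/seteqP; split => x /=.
      by move=> [n _ /=]; apply: lt_trans; rewrite ltrDl invr_gt0.
    rewrite -subr_gt0 => /ltr_add_invr[n]; rewrite add0r => h.
    by exists n => //=; rewrite -ltrBrDl.
  move=> h; apply: cvge_le h; apply: nearW => n.
  have [|s Ss] := @inf_adherent _ S n.+1%:R^-1 _ (conj S0 Slb).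
    by rewrite invr_gt0.
  by move=> /ltW; exact: Sup.
(* Levels below [inf S] are outside [S]; their superlevel sets decrease to the large one,
   [phi >= inf S]. *)
have : mu [set x | phi x > inf S - n.+1%:R^-1]%R @[n --> \oo] -->
    mu (\bigcap_n [set x | phi x > inf S - n.+1%:R^-1]%R).
  apply: (@nonincreasing_cvg_mu _ _ _ mu (fun n => [set x | phi x > inf S - n.+1%:R^-1]%R)) => //.
  - by rewrite (le_lt_trans (probability_le1 _ _))// ltry.
  - exact: bigcap_measurable.
  - move=> m n mn; apply/subsetPset => x /=; apply: le_lt_trans.
    by rewrite lerD2l lerN2 lef_pV2 ?posrE// ler_nat.
rewrite (_ : \bigcap_n _ = [set x | phi x >= inf S]%R); last first.
  apply/seteqP; split => x /=; last first.
    by move=> h n _ /=; apply: lt_le_trans h; rewrite ltrBlDr ltrDl invr_gt0.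
  move=> h; rewrite leNgt; apply/negP; rewrite -subr_gt0 => /ltr_add_invr[n].
  rewrite add0r ltrBrDl -ltrBrDr => h'.
  by have := lt_trans h' (h n I); rewrite ltxx.
move=> h; apply: cvge_ge h; apply: nearW => n; rewrite leNgt; apply/negP => /ltW /(ge_inf Slb).
by rewrite leNgt ltrBlDr ltrDl invr_gt0 ltr0n.
Qed.

(** * The dual side of CVaR: densities bounded by [rho^-1] *)

(** The last clause says that [phi] is integrable under the measure of density [g], so that this
    measure is admissible in [F_safe]. *)
Definition dual_density d (T : measurableType d) (R : realType)
    (mu : probability T R) (phi : T -> R) (rho : R) (g : T -> R) : Prop :=
  [/\ measurable_fun [set: T] g,
      (forall x, 0 <= g x <= rho^-1)%R,
      \int[mu]_x (g x)%:E = 1 &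
      mu.-integrable [set: T] (fun x => (phi x * g x)%:E)].

Section density_CVaR.
Context d (T : measurableType d) (R : realType) (mu : probability T R).
Context (phi : T -> R) (rho : R).
Hypothesis mphi : measurable_fun [set: T] phi.
Hypotheses (rho_gt0 : (0 < rho)%R) (rho_lt1 : (rho < 1)%R).

Let rhoV_ge0 : (0 <= rho^-1)%R. Proof. by rewrite invr_ge0 ltW. Qed.

Let measurable_eq a : measurable [set x | phi x = a].
Proof.
rewrite -[X in measurable X]setTI.
exact: (mphi measurableT (measurable_set1 a)).
Qed.

Let integral_combination (A B : set T) (s t : R) :
  measurable A -> measurable B -> (0 <= s)%R -> (0 <= t)%R ->
  \int[mu]_x (s * \1_A x + t * \1_B x)%:E = s%:E * mu A + t%:E * mu B.
Proof.
move=> mA mB s0 t0; have h C : measurable C ->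
    measurable_fun [set: T] (fun x => (\1_C x : R)%:E).
  by move=> mC; apply/measurable_EFinP; exact: measurable_indic.
under eq_integral do rewrite EFinD !EFinM.
rewrite ge0_integralD//; first last.
- by apply: emeasurable_funM => //; exact: h.
- by move=> x _; rewrite mule_ge0.
- by apply: emeasurable_funM => //; exact: h.
- by move=> x _; rewrite mule_ge0.
rewrite !ge0_integralZl//; [|exact: h..].
by rewrite !integral_indic// !setIT.
Qed.

(* [g] is the extremal density: full mass [rho^-1] above a [(1 - rho)]-quantile
   [a], and the remaining mass spread over [phi = a]. When [phi = a] is
   negligible, [t] is [_ / 0 = 0]. *)
Lemma CVaR_le_integral_density :
  \int[mu]_x (Num.max 0 (phi x))%R%:E < +oo ->
  exists2 g, dual_density mu phi rho g & CVaR rho phi mu <= \int[mu]_x (phi x * g x)%:E.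
Proof.
move=> phi_fin.
have rho01 : (0 < rho < 1)%R by rewrite rho_gt0.
have [a [ale age]] := exists_quantile mu mphi rho01.
pose A := [set x | phi x > a]%R; pose B := [set x | phi x = a].
have mA : measurable A := measurable_superlevel a mphi.
have mB : measurable B := measurable_eq a.
have [p muA] : exists p, mu A = p%:E.
  by exists (fine (mu A)); rewrite fineK// fin_num_measure.
have [q muB] : exists q, mu B = q%:E.
  by exists (fine (mu B)); rewrite fineK// fin_num_measure.
have p0 : (0 <= p)%R by rewrite -lee_fin -muA.
have q0 : (0 <= q)%R by rewrite -lee_fin -muB.
have prho : (p <= rho)%R by rewrite -lee_fin -muA.
have rhopq : (rho <= p + q)%R.
  rewrite -lee_fin EFinD -muA -muB -measureU//; last first.
    by apply/seteqP; split => // x []; rewrite /A /B /= => /[swap] ->; rewrite ltxx.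
  apply: (le_trans age); apply: le_measure; rewrite ?inE//.
  - rewrite (_ : [set x | _] = A `|` B); first exact: measurableU.
    apply/seteqP; split => x; rewrite /A /B /= le_eqVlt.
      by case/predU1P => [->|]; [right|left].
    by move=> [->|->]; rewrite ?eqxx ?orbT.
  - exact: measurableU.
  - move=> x; rewrite /A /B /= le_eqVlt.
    by case/predU1P => [->|]; [right|left].
(* Solves [p / rho + t * q = 1], the normalization of [g]. If [q = 0], then [p <= rho <= p + q]
   forces [p = rho]. *)
pose t := ((1 - p / rho) / q)%R.
have pr1 : (0 <= 1 - p / rho)%R by rewrite subr_ge0 ler_pdivrMr// mul1r.
have t0 : (0 <= t)%R by exact: divr_ge0.
have tq : (p / rho + t * q = 1)%R.
  have [q_eq0|q_neq0] := eqVneq q 0%R; last by rewrite /t divfK// subrKC.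
  have -> : p = rho by apply/eqP; rewrite eq_le prho; lra.
  by rewrite q_eq0 mulr0 addr0 divff// gt_eqF.
have tr : (t <= rho^-1)%R.
  have [q_eq0|q_neq0] := eqVneq q 0%R; first by rewrite /t q_eq0 invr0 mulr0.
  rewrite /t ler_pdivrMr ?lt0r ?q_neq0//.
  have -> : (1 - p / rho = rho^-1 * (rho - p))%R by field; rewrite gt_eqF.
  by rewrite ler_wpM2l//; lra.
pose g x := (rho^-1 * \1_A x + t * \1_B x)%R.
have gE x : g x = (if a < phi x then rho^-1 else if phi x == a then t else 0)%R.
  rewrite /g !indicE (_ : (x \in A) = (a < phi x)%R); last first.
    by apply/idP/idP; rewrite inE.
  rewrite (_ : (x \in B) = (phi x == a)); last first.
    by apply/idP/idP; rewrite inE; move/eqP.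
  by case: ltgtP; rewrite /= ?(mulr0, mulr1, addr0, add0r).
have mg : measurable_fun [set: T] g.
  by apply: measurable_funD; apply: measurable_funM => //; exact: measurable_indic.
have g1 : \int[mu]_x (g x)%:E = 1.
  by rewrite integral_combination// muA muB -!EFinM -EFinD mulrC tq.
have g01 x : (0 <= g x <= rho^-1)%R.
  rewrite gE; case: ifP => _; first by rewrite rhoV_ge0 lexx.
  by case: ifP => _; rewrite ?t0 ?tr ?lexx ?rhoV_ge0.
have g0 x : (0 <= g x)%R by case/andP: (g01 x).
have gi := integrable_density mg g0 g1.
(* Complementary slackness: [g] equals [rho^-1] where [phi > a] and 0 where [phi < a]. Integrated,
   this is the CVaR objective at [a]. *)
have phigE x : (phi x * g x = rho^-1 * Num.max 0 (phi x - a) + a * g x)%R.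
  rewrite gE; case: ltgtP => [pa|pa|->].
  - by rewrite max_r ?subr_ge0 ?(ltW pa)//; ring.
  - by rewrite max_l ?mulr0 ?addr0// subr_le0 ltW.
  - by rewrite subrr maxxx; ring.
have mmax b : measurable_fun [set: T] (fun x => (Num.max 0 (phi x - b))%R%:E).
  apply/measurable_EFinP; apply: measurable_maxr => //.
  exact: measurable_funB.
have phi_int : mu.-integrable [set: T] (fun x => (Num.max 0 (phi x))%R%:E).
  apply/integrableP; split.
    by apply/measurable_EFinP; exact: measurable_maxr.
  by under eq_integral do rewrite /= ger0_norm ?le_max ?lexx//.
have phia_int : mu.-integrable [set: T] (fun x => (Num.max 0 (phi x - a))%R%:E).
  apply: (@le_integrable _ _ _ _ _ measurableT _
    (fun x => (Num.max 0 (phi x))%R%:E + `|a|%:E)) => //; last first.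
    by apply: integrableD => //; exact: finite_measure_integrable_cst.
  move=> x _; rewrite -EFinD !abse_EFin lee_fin.
  rewrite [leLHS]ger0_norm ?le_max ?lexx//.
  rewrite [leRHS]ger0_norm ?addr_ge0 ?le_max ?lexx//.
  rewrite ge_max addr_ge0 ?le_max ?lexx//= lerD ?le_max ?lexx ?orbT//.
  by rewrite -normrN ler_norm.
exists g.
  split => //.
  rewrite (_ : (fun x => _) = (fun x => (rho^-1)%:E * (Num.max 0 (phi x - a))%R%:E
     + a%:E * (g x)%:E)); last by apply/funext => x; rewrite phigE EFinD !EFinM.
  by apply: integrableD => //; exact: integrableZl.
under eq_integral do rewrite phigE EFinD !EFinM.
rewrite integralD//=; [|exact: integrableZl..].
rewrite !integralZl// g1 mule1 addeC.
by apply: ereal_inf_lbound; exists a.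
Qed.

(* When [phi] has infinite positive part, [CVaR] is infinite; the densities put
   mass [1] on [K < phi <= n] and the rest on [|phi| <= K], whose mass
   exceeds [rho]. *)
Lemma integral_density_unbounded (M : R) :
  \int[mu]_x (Num.max 0 (phi x))%R%:E = +oo ->
  exists2 g, dual_density mu phi rho g & M%:E <= \int[mu]_x (phi x * g x)%:E.
Proof.
move=> phi_oo.
have mle a : measurable [set x | `|phi x| <= a]%R.
  rewrite -[X in measurable X]setTI.
  rewrite (_ : [set x | _] = (fun x => `|phi x|)%R @^-1` `]-oo, a]%classic).
    by apply: measurableT_comp.
  by apply/seteqP; split => x /=; rewrite in_itv.
have [K rhoK] : exists K : nat, rho%:E <= mu [set x | `|phi x| <= K%:R]%R.
  have : mu [set x | `|phi x| <= n%:R]%R @[n --> \oo] -->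
      mu (\bigcup_n [set x | `|phi x| <= n%:R]%R).
    apply: (@nondecreasing_cvg_mu _ _ _ mu (fun n => [set x | `|phi x| <= n%:R]%R)) => //.
    - exact: bigcup_measurable.
    - move=> m n mn; apply/subsetPset => x /= /le_trans; apply.
      by rewrite ler_nat.
  rewrite (_ : \bigcup_n _ = setT) ?probability_setT; last first.
    apply/seteqP; split => // x _; exists (Num.bound `|phi x|%R) => //=.
    by rewrite ltW// archi_boundP.
  move=> h; apply: contrapT => noK.
  suff : 1 <= rho%:E by rewrite lee_fin leNgt rho_lt1.
  apply: cvge_le h; apply: nearW => n; rewrite leNgt; apply/negP => /ltW rhon.
  by apply: noK; exists n.
pose A := [set x | `|phi x| <= K%:R]%R.
pose B n := [set x | K%:R < phi x <= n%:R]%R.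
have mA : measurable A by exact: mle.
have mB n : measurable (B n).
  rewrite -[X in measurable X]setTI.
  rewrite (_ : B n = phi @^-1` `]K%:R, n%:R]%classic); first exact: mphi.
  by apply/seteqP; split => x /=; rewrite in_itv.
have mphiB n : measurable_fun [set: T] (fun x => (phi x * \1_(B n) x)%:E).
  by apply/measurable_EFinP; apply: measurable_funM => //; exact: measurable_indic.
have phiB0 n x : 0 <= (phi x * \1_(B n) x)%:E.
  rewrite lee_fin indicE; case: (boolP (x \in B n)) => [|_]; last by rewrite mulr0.
  by rewrite inE => -[/andP[+ _]]; rewrite mulr1 => /ltW; apply: le_trans.
(* The target [M + K] leaves room for the loss of at most [K] incurred on [A]. If no [n] reached it,
   monotone convergence would make the integral of the positive part finite. *)
have [n nM] : exists n, (M + K%:R)%:E <= \int[mu]_x (phi x * \1_(B n) x)%:E.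
  apply: contrapT => no.
  have [nB cB] : (forall x, nondecreasing_seq (fun n => (phi x * \1_(B n) x)%:E)) /\
    (forall x, (Num.max 0 (phi x))%:E <= K%:R%:E + limn (fun n => (phi x * \1_(B n) x)%:E)).
    have nd x : nondecreasing_seq (fun n => (phi x * \1_(B n) x)%:E).
      move=> m n mn; rewrite lee_fin !indicE.
      case: (boolP (x \in B m)) => [|_]; last by rewrite mulr0 -lee_fin -indicE.
      rewrite inE => -[/andP[h1 h2]]; rewrite (_ : x \in B n) ?inE//.
      by rewrite /B /= h1 (le_trans h2)// ler_nat.
    split => // x.
    have [xK|xK] := leP (phi x) K%:R%R.
      rewrite -[leLHS]adde0; apply: leeD.
        by rewrite lee_fin ge_max ler0n.
      apply: lime_ge; first exact: ereal_nondecreasing_is_cvgn.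
      by apply: nearW => m; exact: phiB0.
    rewrite max_r; last by rewrite (le_trans _ (ltW xK)).
    rewrite -[leLHS]add0e; apply: leeD; first by rewrite lee_fin.
    apply: lime_ge; first exact: ereal_nondecreasing_is_cvgn.
    exists (Num.bound `|phi x|%R) => // m /= bm.
    rewrite lee_fin indicE (_ : x \in B m) ?mulr1// inE /B /= xK/=.
    rewrite (le_trans (ler_norm _))// (le_trans (ltW (archi_boundP _)))//.
    by rewrite ler_nat.
  suff : \int[mu]_x (Num.max 0 (phi x))%R%:E <= (K%:R + (M + K%:R))%:E.
    by rewrite phi_oo leye_eq.
  apply: (@le_trans _ _ (\int[mu]_x (K%:R%:E + limn (fun n => (phi x * \1_(B n) x)%:E)))).
    apply: ge0_le_integral => //.
    - by move=> x _; rewrite lee_fin le_max lexx.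
    - by apply/measurable_EFinP; exact: measurable_maxr.
    - apply: emeasurable_funD => //; apply: emeasurable_fun_cvg mphiB _ => x _.
      exact: ereal_nondecreasing_is_cvgn.
  have lim0 x : 0 <= limn (fun n => (phi x * \1_(B n) x)%:E).
    apply: lime_ge; first exact: ereal_nondecreasing_is_cvgn.
    by apply: nearW => m; exact: phiB0.
  rewrite ge0_integralD//; last first.
    apply: emeasurable_fun_cvg mphiB _ => x _.
    exact: ereal_nondecreasing_is_cvgn.
  rewrite integral_cst//= probability_setT mule1 EFinD leeD2l//.
  rewrite monotone_convergence//.
  apply: lime_le.
    apply: ereal_nondecreasing_is_cvgn => k l kl; apply: ge0_le_integral => //.
    by move=> x _; exact: nB.
  apply: nearW => k; rewrite leNgt; apply/negP => /ltW h.
  by apply: no; exists k.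
have [m muA] : exists m, mu A = m%:E.
  by exists (fine (mu A)); rewrite fineK// fin_num_measure.
have [b muB] : exists b, mu (B n) = b%:E.
  by exists (fine (mu (B n))); rewrite fineK// fin_num_measure.
have rhom : (rho <= m)%R by rewrite -lee_fin -muA.
have m0 : (0 < m)%R := lt_le_trans rho_gt0 rhom.
have b0 : (0 <= b)%R by rewrite -lee_fin -muB.
have b1 : (b <= 1)%R by rewrite -lee_fin -muB probability_le1.
(* The height on [A] that brings the total mass to 1; [m >= rho] keeps it at most [rho^-1]. *)
pose c := ((1 - b) / m)%R.
have c0 : (0 <= c)%R by rewrite divr_ge0 ?subr_ge0// ltW.
have cr : (c <= rho^-1)%R.
  rewrite /c; apply: (@le_trans _ _ (1 / m)%R).
    by rewrite ler_pM2r ?invr_gt0// gerBl.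
  by rewrite div1r lef_pV2 ?posrE.
have r1 : (1 <= rho^-1)%R by rewrite invf_ge1// ltW.
pose g x := (1 * \1_(B n) x + c * \1_A x)%R.
have gE x : g x = (if K%:R < phi x <= n%:R then 1
    else if `|phi x| <= K%:R then c else 0)%R.
  rewrite /g !indicE (_ : (x \in A) = (`|phi x| <= K%:R)%R); last first.
    by apply/idP/idP; rewrite inE.
  rewrite (_ : (x \in B n) = (K%:R < phi x <= n%:R)%R); last first.
    by apply/idP/idP; rewrite inE.
  case: ifPn => [/andP[h _]|_].
    by rewrite leNgt (lt_le_trans h (ler_norm _)) !mulr1 mulr0 addr0.
  by case: ifP => _; rewrite ?(mulr0, mulr1, addr0, add0r).
have mg : measurable_fun [set: T] g.
  by apply: measurable_funD; apply: measurable_funM => //; exact: measurable_indic.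
have g1 : \int[mu]_x (g x)%:E = 1.
  rewrite integral_combination// muA muB -!EFinM -EFinD /c divfK ?gt_eqF//.
  by rewrite mul1r subrKC.
have g01 x : (0 <= g x <= rho^-1)%R.
  rewrite gE; case: ifP => _; first by rewrite ler01.
  by case: ifP => _; rewrite ?c0 ?cr ?lexx ?rhoV_ge0.
have g0 x : (0 <= g x)%R by case/andP: (g01 x).
have gi := integrable_density mg g0 g1.
(* On the support of [g], [|phi|] is at most [K] or at most [n], hence at most [K + n]. *)
have phigi : mu.-integrable [set: T] (fun x => (phi x * g x)%:E).
  apply: (@le_integrable _ _ _ _ _ measurableT _
    (fun x => (K%:R + n%:R)%:E * (g x)%:E)) => //; last exact: integrableZl.
    by apply/measurable_EFinP; exact: measurable_funM.
  move=> x _; rewrite -EFinM !abse_EFin lee_fin !normrM.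
  rewrite gE; case: ifPn => [/andP[h1 h2]|_].
    rewrite ler_wpM2r// !ger0_norm ?addr_ge0//; last first.
      by rewrite (le_trans _ (ltW h1)).
    by rewrite (le_trans h2)// lerDr.
  case: ifPn => [h|_]; last by rewrite normr0 !mulr0.
  by rewrite ler_wpM2r// (le_trans h)// [leRHS]ger0_norm ?addr_ge0// lerDl.
exists g; first by split.
have -> : M%:E = (M + K%:R)%:E + (- K%:R)%:E :> \bar R by rewrite -EFinD addrK.
have phiBi : mu.-integrable [set: T] (fun x => (phi x * \1_(B n) x)%:E).
  apply: le_integrable phigi => // x _.
  rewrite !abse_EFin lee_fin !normrM ler_wpM2l//.
  by rewrite !ger0_norm// /g mul1r lerDl mulr_ge0.
(* Pointwise [phi * g >= phi * \1_(B n) - K * g]: on [B n] because [K >= 0], on [A] because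
   [phi >= - K]. The right side integrates to at least [(M + K) - K]. *)
apply: (@le_trans _ _ (\int[mu]_x ((phi x * \1_(B n) x)%:E + (- K%:R)%:E * (g x)%:E))).
  rewrite integralD//=; last exact: integrableZl.
  by rewrite integralZl// g1 mule1 leeD2r.
apply: le_integral => //.
  by apply: integrableD => //; exact: integrableZl.
move=> x _; rewrite -EFinM -EFinD lee_fin mulNr -lerBrDr opprK -mulrDl.
rewrite indicE (_ : (x \in B n) = (K%:R < phi x <= n%:R)%R); last first.
  by apply/idP/idP; rewrite inE.
rewrite gE; case: ifPn => _ /=; first by rewrite !mulr1 lerDl.
rewrite mulr0; case: ifPn => [|_]; last by rewrite mulr0.
by rewrite ler_norml => /andP[h _]; rewrite mulr_ge0//; lra.
Qed.

(** The hard half of CVaR duality, with an arbitrary upper bound [y] in place of the supremum. The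
    extremal density settles the case of an integrable positive part; otherwise the dual values are
    unbounded and [y] is infinite. *)
Lemma CVaR_le_dual (y : \bar R) :
  (forall g, dual_density mu phi rho g -> \int[mu]_x (phi x * g x)%:E <= y) ->
  CVaR rho phi mu <= y.
Proof.
move=> h.
have [phi_fin|] := ltP (\int[mu]_x (Num.max 0 (phi x))%R%:E) +oo.
  by have [g dg le_g] := CVaR_le_integral_density phi_fin; exact: le_trans (h _ dg).
rewrite leye_eq => /eqP phi_oo.
suff -> : y = +oo by rewrite leey.
apply/eqyP => M _; have [g dg le_g] := integral_density_unbounded M phi_oo.
exact: le_trans (h _ dg).
Qed.

End density_CVaR.

(** * Comparison of CVaR with the Safe KL functional *)

Section CVaR_F_safe.
Context d (T : measurableType d) (R : realType) (mu : probability T R).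
Context (phi : T -> R) (rho lambda : R).
Hypothesis mphi : measurable_fun [set: T] phi.
Hypotheses (rho_gt0 : (0 < rho)%R) (rho_lt1 : (rho < 1)%R).
Hypothesis lambda_gt0 : (0 < lambda)%R.

Let integral_scale (nu : probability T R) :
  nu.-integrable [set: T] (EFin \o phi) ->
  \int[nu]_x (phi x / lambda)%:E = (lambda^-1)%:E * \int[nu]_x (phi x)%:E.
Proof.
move=> phi_int; rewrite -integralZl//.
by apply: eq_integral => x _; rewrite -EFinM mulrC.
Qed.

Lemma CVaR_le_F_safe :
  CVaR rho phi mu + (lambda * (ln rho - 1))%:E
    <= lambda%:E * F_safe rho (fun x => (phi x / lambda)%R) mu.
Proof.
(* With the constant moved to the right, that side plays the role of [y], to be tested against each
   dual density. *)
rewrite -leeBrDr//; apply: (CVaR_le_dual mphi rho_gt0 rho_lt1) => g [mg g01 g1 phig].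
have g0 x : (0 <= g x)%R by case/andP: (g01 x).
have [nu nuE] := density_probability mg g0 g1.
have phi_int := integrable_densityM mg g0 nuE mphi phig.
rewrite -(integral_densityM mg nuE phi_int) leeBrDr//.
have rho01 : (0 < rho < 1)%R by rewrite rho_gt0.
have KLle : safeKL rho nu mu <= (1 - ln rho)%:E.
  by apply: (safeKL_density_le mg g0 nuE rho01) => x; case/andP: (g01 x).
have psi_int : nu.-integrable [set: T] (fun x => (phi x / lambda)%:E).
  rewrite (_ : (fun x => _) = (fun x => (lambda^-1)%:E * (phi x)%:E)).
    exact: integrableZl.
  by apply/funext => x; rewrite -EFinM mulrC.
(* The measure of density [g] competes in the supremum, and its divergence is at most
   [1 - ln rho]. *)
apply: (@le_trans _ _ (lambda%:E *
    (\int[nu]_x (phi x / lambda)%:E - safeKL rho nu mu))).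
  rewrite integral_scale//.
  have : \int[nu]_x (phi x)%:E \is a fin_num by exact: integrable_fin_num.
  case: (\int[nu]_x (phi x)%:E) => // r _.
  rewrite -lee_pdivrMl//.
  apply: (@le_trans _ _ ((lambda^-1 * r)%:E - (1 - ln rho)%:E)).
    rewrite -!EFinD -EFinM lee_fin mulrDr mulrA mulVf ?gt_eqF//; lra.
  by rewrite -EFinM leeB.
rewrite lee_pmul2l//; apply: ereal_sup_ubound; exists nu => //=.
by have /integrableP[] := psi_int.
Qed.

Lemma F_safe_le_CVaR :
  lambda%:E * F_safe rho (fun x => (phi x / lambda)%R) mu
    <= CVaR rho phi mu + (lambda * (ln rho - 1 + rho^-1))%:E.
Proof.
rewrite muleC -lee_pdivlMr//.
apply: ge_ereal_sup => _ [nu /= psi_fin <-].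
rewrite lee_pdivlMr// muleC -leeBlDr//.
(* Supremum and infimum are now both opened: it remains to compare one [nu] with one level [a]. *)
apply: le_ereal_inf_tmp => _ [a _ <-].
rewrite leeBlDr//.
have [KLfin|] := ltP (safeKL rho nu mu) +oo; last first.
  (* Infinite divergence: the integral of [phi / lambda] under [nu] is finite, so the difference is
     [-oo]. *)
  rewrite leye_eq => /eqP ->.
  have psi_int : nu.-integrable [set: T] (fun x => (phi x / lambda)%:E).
    apply/integrableP; split => //.
    by apply/measurable_EFinP; exact: measurable_funM.
  have : \int[nu]_x (phi x / lambda)%:E \is a fin_num by exact: integrable_fin_num.
  case: (\int[nu]_x (phi x / lambda)%:E) => // r _.
  by rewrite addeNy gt0_muleNy ?lte_fin// leNye.
have phi_int : nu.-integrable [set: T] (EFin \o phi).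
  rewrite (_ : EFin \o phi = (fun x => lambda%:E * (phi x / lambda)%:E)).
    apply: integrableZl => //; apply/integrableP; split => //.
    by apply/measurable_EFinP; exact: measurable_funM.
  by apply/funext => x; rewrite -EFinM mulrCA mulfV ?gt_eqF// mulr1.
rewrite integral_scale//.
have mpos : measurable_fun [set: T] (fun x => (Num.max 0 (phi x - a))%R%:E).
  apply/measurable_EFinP; apply: measurable_maxr => //.
  exact: measurable_funB.
have pos0 x : 0 <= (Num.max 0 (phi x - a))%R%:E.
  by rewrite lee_fin le_max lexx.
have le_pos := ge0_le_integral_of_safeKL rho_gt0 KLfin mpos pos0.
(* Weak duality: integrate [phi <= a + (phi - a)_+] under [nu], then pass to [mu] at the cost of a
   factor [rho^-1]. *)
have phi_le : \int[nu]_x (phi x)%:E <=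
    a%:E + (rho^-1)%:E * \int[mu]_x (Num.max 0 (phi x - a))%R%:E.
  apply: le_trans (leeD2l a%:E le_pos).
  have pos_int : nu.-integrable [set: T] (fun x => (Num.max 0 (phi x - a))%R%:E).
    apply: (@le_integrable _ _ _ _ _ measurableT _
      (fun x => (phi x)%:E - a%:E)) => //; last first.
      by apply: integrableB => //; exact: finite_measure_integrable_cst.
    move=> x _; rewrite -EFinB !abse_EFin lee_fin.
    by rewrite ger0_norm ?le_max ?lexx// ge_max normr_ge0 ler_norm.
  have -> : a%:E = \int[nu]_x a%:E by rewrite integral_cst//= probability_setT mule1.
  rewrite -integralD//=; last exact: finite_measure_integrable_cst.
  apply: le_integral => //.
    by apply: integrableD => //; exact: finite_measure_integrable_cst.
  move=> x _; rewrite -EFinD lee_fin -lerBlDl le_max lexx orbT//.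
apply: le_trans (leeD2r _ phi_le).
have := safeKL_ge_of_finite rho_gt0 KLfin.
have : \int[nu]_x (phi x)%:E \is a fin_num by exact: integrable_fin_num.
case: (\int[nu]_x (phi x)%:E) => // r _.
move: KLfin; case: (safeKL rho nu mu) => // k _.
rewrite !lee_fin => /(ler_wpM2l (ltW lambda_gt0)) hk.
rewrite mulrDr mulrN mulVKf ?gt_eqF//; move: hk.
by rewrite !mulrDr !mulrN; lra.
Qed.

End CVaR_F_safe.

Theorem proposition2p6 (d : measure_display) (T : measurableType d)
    (R : realType) (mu : probability T R) (phi : T -> R)
    (mphi : measurable_fun [set: T] phi) (rho lambda : R)
    (rho_gt0 : (0 < rho)%R) (rho_lt1 : (rho < 1)%R)
    (lambda_gt0 : (0 < lambda)%R) :
  CVaR rho phi mu + (lambda * (ln rho - 1))%:E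
    <= lambda%:E * F_safe rho (fun x => (phi x / lambda)%R) mu /\
  lambda%:E * F_safe rho (fun x => (phi x / lambda)%R) mu
    <= CVaR rho phi mu + (lambda * (ln rho - 1 + rho^-1))%:E.
Proof.
split; first exact: CVaR_le_F_safe.
exact: F_safe_le_CVaR.
Qed.
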